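(* Assume $r>1$, and define $F:\mathbb{R}\to\mathbb{R}$ by $$F(y)=-1+\exp\left[\frac{ry+1-e^{ry}}{y}\right]\quad (y\neq 0),\qquad F(0)=0.$$ Let $y(t)$ be a solution of Wright's equation $$y'(t)=-r\,y(t-1)\,(1+y(t))$$ with $y(0)>-1$. Then $$F^2(-1)\le\liminf_{t\to\infty}y(t)\le\limsup_{t\to\infty}y(t)\le F(-1)=-1+\exp\left(-1+r+e^{-r}\right).$$
   Context: A solution of Wright's equation is a continuous function $y:[-1,\infty)\to\mathbb{R}$, determined by a continuous initial function $\phi$ on $[-1,0]$ (so $y=\phi$ on $[-1,0]$), which is differentiable and satisfies the equation for all $t>0$. The condition $y(0)>-1$ means $\phi(0)>-1$. $F^2=F\circ F$ denotes the second iterate under composition. *)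

(* Defs.v *)
From HB Require Import structures.
From mathcomp Require Import all_boot all_order all_algebra.
From mathcomp Require Import all_classical all_reals all_analysis.
Set Implicit Arguments.
Unset Strict Implicit.
Unset Printing Implicit Defensive.
Import Order.TTheory GRing.Theory Num.Theory.
Import numFieldNormedType.Exports.
Local Open Scope classical_set_scope.
Local Open Scope ring_scope.

Definition wrightF (R : realType) (r : R) (y : R) : R :=
  if y == 0 then 0
  else -1 + expR ((r * y + 1 - expR (r * y)) / y).

(* Solutions live on [-1, +oo[; they are encoded as total functions whose
   values on ]-oo, -1[ are unconstrained and play no role, since the equation
   is only imposed for t > 0.  Similarly only phi on [-1, 0] matters. *)
Record wright_solution (R : realType) (r : R) (phi y : R -> R) : Prop :=
  WrightSolution {
    wright_init_continuous : {within `[-1, 0], continuous phi};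
    wright_init : forall t : R, -1 <= t <= 0 -> y t = phi t;
    wright_continuous : {within `[-1, +oo[, continuous y};
    wright_equation : forall t : R, 0 < t ->
      is_derive t 1 y (- r * y (t - 1) * (1 + y t))
  }.

(* Main.v *)
(* With x = ln (1 + y), Wright's equation becomes x'(t) = - f (x (t - 1)), where
   f u = r (exp u - 1) is increasing and has the sign of u.  If f (x) >= - A,
   then x' <= A, so before a zero s of x one has x(u) >= A (u - s); feeding this
   back into the equation bounds x on [s, s + 1] by the integral of
   - f (A u) over [-1, 0], and after s + 1 the solution x decreases as long as it
   stays positive.  This gives an eventual upper bound for x from A = r
   (y > -1), and then an eventual lower bound by applying the same argument to
   - x with A = r F(-1). *)
Require Import Defs.
From HB Require Import structures.
From mathcomp Require Import all_boot all_order all_algebra.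
From mathcomp Require Import all_classical all_reals all_analysis.
From mathcomp Require Import ring lra.
Set Implicit Arguments.
Unset Strict Implicit.
Unset Printing Implicit Defensive.
Import Order.TTheory GRing.Theory Num.Theory.
Import numFieldNormedType.Exports.
Local Open Scope classical_set_scope.
Local Open Scope ring_scope.

(** * Comparison of increments and last zeros *)

Lemma is_derive_continuous (R : realType) (f : R -> R) (x df : R) :
  is_derive x 1 f df -> {for x, continuous f}.
Proof.
move=> [dfx _]; apply: differentiable_continuous.
exact/derivable1_diffP.
Qed.

Lemma is_derive_within_continuous (R : realType) (f df : R -> R) (a b : R) :
  (forall t, a <= t <= b -> is_derive t 1 f (df t)) ->
  {within `[a, b], continuous f}.
Proof.
move=> fd; apply: derivable_within_continuous => t; rewrite in_itv/= => tab.
by have [] := fd t tab.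
Qed.

Lemma ler_increment (R : realType) (f g df dg : R -> R) (a b : R) :
  a <= b -> (forall t, a <= t <= b -> is_derive t 1 f (df t)) ->
  (forall t, a <= t <= b -> is_derive t 1 g (dg t)) ->
  (forall t, a <= t <= b -> df t <= dg t) ->
  f b - f a <= g b - g a.
Proof.
move=> ab fd gd le_d.
have hd t : a <= t <= b -> is_derive t 1 (g - f) (dg t - df t).
  by move=> tab; apply: is_deriveD; [exact: gd|apply: is_deriveN; exact: fd].
have hdo t : t \in `]a, b[ -> is_derive t 1 (g - f) (dg t - df t).
  by rewrite in_itv/= => /andP[? ?]; apply: hd; rewrite !ltW.
have [c] := MVT_segment ab hdo (is_derive_within_continuous hd).
rewrite in_itv/= => cab E.
have : 0 <= (dg c - df c) * (b - a).
  by rewrite mulr_ge0// subr_ge0// le_d.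
by rewrite -E !fctE; lra.
Qed.

(** Take [s] to be the supremum of the points of [a, b] where [f] is nonpositive. Continuity rules
    out [0 < f s]; if [f s < 0], the intermediate value theorem would give a zero beyond [s]. *)
Lemma last_zero (R : realType) (f : R -> R) (a b : R) :
  a <= b -> (forall t, a <= t <= b -> {for t, continuous f}) ->
  f a <= 0 -> 0 < f b ->
  exists s, [/\ a <= s < b, f s = 0 & forall u, s < u <= b -> 0 < f u].
Proof.
move=> ab fc fa fb.
pose S := [set u | a <= u <= b /\ f u <= 0].
have Sa : S a by split=> //; rewrite lexx.
have ubS : ubound S b by move=> u [/andP[_ ub] _].
have supS : has_sup S by split; [exists a|exists b].
have as_ : a <= sup S by apply: sup_upper_bound.
have sb : sup S <= b by apply: ge_sup => //; exists a.
have Spos u : sup S < u <= b -> 0 < f u.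
  move=> /andP[su ub]; rewrite ltNge; apply/negP => fu.
  have : u <= sup S by apply: sup_upper_bound => //; split=> //; lra.
  by rewrite leNgt su.
have fs0 : f (sup S) <= 0.
  rewrite leNgt; apply/negP => fs.
  have /fc/cvgrPdist_lt/(_ _ fs) : a <= sup S <= b by lra.
  move=> /nbhs_ballP[e /= e0 He].
  have [u [uab fu0] us] := sup_adherent e0 supS.
  have us' : u <= sup S by apply: sup_upper_bound.
  have /He : ball (sup S) e u by rewrite /ball/= ger0_norm; lra.
  by rewrite /= ltr_norml; lra.
have sltb : sup S < b.
  by rewrite lt_neqAle sb andbT; apply/eqP => E; rewrite E in fs0; lra.
exists (sup S); split => //; first by rewrite as_.
apply/eqP; rewrite eq_le fs0 leNgt; apply/negP => fsn.
have fc' : {within `[sup S, b], continuous f}.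
  apply: continuous_in_subspaceT => t; rewrite inE/= in_itv/= => tsb.
  by apply: fc; lra.
have [|c] := IVT (v := 0) sb fc'.
  by rewrite ge_min le_max fs0 (ltW fb) orbT.
rewrite in_itv/= => /andP[sc cb] fc0.
have : 0 < f c.
  apply: Spos; rewrite cb andbT lt_neqAle sc andbT.
  by apply/eqP => E; rewrite E fc0 ltxx in fsn.
by rewrite fc0 ltxx.
Qed.

(** * Eventual upper bound under delayed negative feedback *)

(* [G] is a primitive of [f], so that the bound below is the integral of
   [- f (A * u)] over [-1, 0]. *)
Lemma delay_feedback_ub (R : realType) (f G x : R -> R) (A T : R) :
  0 < A -> {homo f : u v / u < v} -> f 0 = 0 ->
  (forall u : R, is_derive u 1 G (f u)) ->
  (forall t : R, T <= t -> is_derive t 1 x (- f (x (t - 1)))) ->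
  (forall t, T <= t -> - A <= f (x (t - 1))) ->
  exists2 T', T <= T' & forall t, T' <= t -> x t <= (G (- A) - G 0) / A.
Proof.
move=> A0 fmono f0 dG dx fA.
have fle u v : u <= v -> f u <= f v.
  by rewrite le_eqVlt => /predU1P[->//|/fmono/ltW].
have xc t : T <= t -> {for t, continuous x}.
  by move=> Tt; exact: is_derive_continuous (dx t Tt).
set C := _ / A.
have Gmin (u : R) : u < 0 -> G 0 < G u.
  move=> u0.
  have [c] := MVT u0 (fun x _ => dG x)
    (is_derive_within_continuous (fun t _ => dG t)).
  rewrite in_itv/= => /andP[_ c0] E.
  have fc : f c < 0 by rewrite -[ltRHS]f0 fmono.
  have : 0 < - f c * (0 - u) by rewrite mulr_gt0//; lra.
  by lra.
have C0 : 0 < C by rewrite divr_gt0// subr_gt0 Gmin//; lra.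
have bump (s t : R) : T + 1 <= s -> x s = 0 -> s <= t <= s + 1 -> x t <= C.
  move=> Ts xs st.
  (* Since x' <= A, going back from the zero [s] keeps [x] above the line of slope [A] through
     it. *)
  have lin (u : R) : s - 1 <= u <= s -> A * (u - s) <= x u.
    move=> us; have [_ us'] := andP us.
    suff : x s - x u <= (A \*: id : R -> R) s - (A \*: id : R -> R) u.
      by rewrite xs /= /GRing.scale/=; lra.
    apply: (@ler_increment R _ _ (fun v => - f (x (v - 1))) (fun=> A)) => // v hv.
    - by apply: dx; lra.
    - by apply: (is_derive_eq (is_deriveZ _ _)); rewrite /GRing.scale/= mulr1.
    - by have := fA v; lra.
  (* By [lin] and monotonicity of [f], x'(v) is at most - f (A (v - 1 - s)); [g] is a primitive of
     this bound. *)
  pose g (v : R) : R := - A^-1 * G (A * (v - 1 - s)).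
  have dg (v : R) : is_derive v 1 g (- f (A * (v - 1 - s))).
    have dl : is_derive v 1 (A \*: (id - cst (1 + s)) : R -> R) A.
      apply: (is_derive_eq (is_deriveZ _ (is_deriveB _ _))).
      by rewrite subr0 /GRing.scale/= mulr1.
    have -> : g = (- A^-1) \*: (G \o (A \*: (id - cst (1 + s)))).
      by apply/funext => w; rewrite /g !fctE /= /GRing.scale/= opprD addrA.
    apply: (is_derive_eq (is_deriveZ _ (is_derive1_comp (dG _) dl))).
    rewrite !fctE /GRing.scale/= opprD addrA mulrCA mulNr mulVf ?gt_eqF//.
    by rewrite mulrN1.
  have st' : s <= t by lra.
  have : x t - x s <= g t - g s.
    apply: (@ler_increment R _ _ (fun v => - f (x (v - 1)))
      (fun v => - f (A * (v - 1 - s)))) => // v hv.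
      by apply: dx; lra.
    by rewrite lerN2; apply: fle; apply: lin; lra.
  rewrite xs subr0 => /le_trans; apply.
  have -> : g t - g s = (G (- A) - G (A * (t - 1 - s))) / A.
    rewrite /g (_ : A * (s - 1 - s) = - A); last by ring.
    by field; rewrite gt_eqF.
  (* The argument A (t - 1 - s) is nonpositive, and [G] is at least [G 0] there. *)
  rewrite ler_pM2r ?invr_gt0// lerB//.
  have [->|t0] := eqVneq (t - 1 - s) 0; first by rewrite mulr0.
  by apply/ltW/Gmin; rewrite pmulr_rlt0// lt_neqAle t0/=; lra.
have fall (s t : R) : T + 1 <= s -> s + 1 <= t -> (forall u, s <= u <= t -> 0 <= x u) ->
    x t <= x (s + 1).
  move=> Ts st xpos.
  suff : x t - x (s + 1) <= cst (0 : R) t - cst (0 : R) (s + 1) by rewrite /cst; lra.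
  apply: (@ler_increment R _ _ (fun v => - f (x (v - 1))) (fun=> 0)) => // v hv.
  - by apply: dx; lra.
  - have : 0 <= f (x (v - 1)) by rewrite -[leLHS]f0; apply: fle; apply: xpos; lra.
    by lra.
(* If [x] is nonpositive at some time, each later positive value is traced back to the last zero [z]
   before it: [bump] covers one delay after [z], [fall] the rest. Otherwise [x] stays positive,
   hence is eventually nonincreasing. *)
have [[s Ts xs]|pos] := pselect (exists2 s, T + 1 <= s & x s <= 0).
  exists s; first lra.
  move=> t st; have [|xt] := leP (x t) 0; first by move/le_trans; apply; exact: ltW.
  have [|z [/andP[sz zt] xz zpos]] := last_zero st _ xs xt.
    by move=> u /andP[su _]; apply: xc; lra.
  have [tz|/ltW tz] := leP t (z + 1).
    by apply: (bump z) => //; lra.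
  have zge u : z <= u <= t -> 0 <= x u.
    move=> /andP[]; rewrite le_eqVlt => /predU1P[<- _|zu ut]; first by rewrite xz.
    by apply/ltW/zpos; rewrite zu.
  have z1 : x (z + 1) <= C by apply: (bump z) => //; lra.
  by apply: le_trans z1; apply: fall => //; lra.
have xpos t : T + 1 <= t -> 0 < x t.
  by move=> Tt; rewrite ltNge; apply/negP => xt; apply: pos; exists t.
have anti (s t : R) : T + 2 <= s -> s <= t -> x t <= x s.
  move=> Ts st.
  have E : x s = x ((s - 1) + 1) by rewrite subrK.
  rewrite E; apply: fall; [lra|lra|move=> u su; apply/ltW/xpos; lra].
have [[s Ts xs]|big] := pselect (exists2 s, T + 2 <= s & x s <= C).
  exists s; first lra.
  by move=> t st; apply: le_trans (anti s t _ _) xs.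
have fC : 0 < f C by rewrite -[ltLHS]f0 fmono.
have x0 : 0 < x (T + 3) by apply: xpos; lra.
(* While [x] exceeds [C], its slope is at most - f C one delay later. At this [t] the line of that
   slope from [x (T + 3)] reaches 0, contradicting positivity. *)
pose t : R := T + 3 + x (T + 3) / f C.
have Tt : T + 3 <= t by rewrite lerDl divr_ge0// ltW.
have : x t - x (T + 3) <= (- f C \*: id : R -> R) t - (- f C \*: id : R -> R) (T + 3).
  apply: (@ler_increment R _ _ (fun v => - f (x (v - 1))) (fun=> - f C)) => // v hv.
  - by apply: dx; lra.
  - by apply: (is_derive_eq (is_deriveZ _ _)); rewrite /GRing.scale/= mulr1.
  - rewrite lerN2; apply: fle; rewrite leNgt; apply/negP => /ltW xC.
    by apply: big; exists (v - 1) => //; lra.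
rewrite /= /GRing.scale/= -mulrBr (_ : t - (T + 3) = x (T + 3) / f C); last first.
  by rewrite /t; ring.
rewrite mulNr mulrCA divff ?gt_eqF// mulr1 => xt.
have : 0 < x t by apply: xpos; lra.
by lra.
Qed.

(** * Solutions stay above -1 *)

(** At a zero [c] of 1 + y, the weight [w] = (1 + y)^2 exp (2 K u) would vanish. But [w 0] is
    positive and [w] cannot decrease on [0, c], because [K] bounds r y on [-1, c - 1], where the
    delayed argument lies. *)
Lemma wright_gtN1 (R : realType) (r : R) (phi y : R -> R) (t : R) :
  0 < r -> wright_solution r phi y -> -1 < y 0 -> 0 <= t -> -1 < y t.
Proof.
move=> r0 [_ _ yc ydiff] y0 t0; rewrite ltNge; apply/negP => yt.
have yc' (a b : R) : -1 <= a -> {within `[a, b], continuous y}.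
  move=> a1; apply: continuous_subspaceW yc => u /=.
  by rewrite !in_itv/= andbT => /andP[+ _]; apply: le_trans.
have [|c] := IVT (v := -1) t0 (yc' 0 t (lerN10 R)).
  by rewrite ge_min le_max yt (ltW y0) orbT.
rewrite in_itv/= => /andP[c0 _] ycN1.
have {}c0 : 0 < c.
  by rewrite lt_neqAle c0 andbT; apply/eqP => E; rewrite E ycN1 ltxx in y0.
have c1 : -1 <= c - 1 by lra.
have [m _ ym] := EVT_max c1 (yc' _ _ (lexx _)).
pose K := r * y m.
(* Squaring [1 + y] makes the sign of [w'] independent of that of [1 + y]. *)
pose u1 : R -> R := cst 1 + y.
pose e : R -> R := expR \o (2 * K \*: id).
pose w : R -> R := u1 * u1 * e.
have wd u : u \in `]0, c[ -> is_derive u 1 w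
    (2 * (K - r * y (u - 1)) * (1 + y u) ^+ 2 * expR (2 * K * u)).
  rewrite in_itv/= => /andP[u0 uc].
  have yd := ydiff u u0.
  have u1d := is_deriveD (is_derive_cst (1 : R) u 1) yd.
  have ed := is_derive1_comp (is_derive_expR ((2 * K \*: (id : R -> R)) u))
    (is_deriveZ (2 * K) (is_derive_id u 1)).
  apply: (is_derive_eq (is_deriveM (is_deriveM u1d u1d) ed)).
  by rewrite /u1 /e !fctE /GRing.scale/= ; ring.
have wc : {within `[0, c], continuous w}.
  have yc0 := yc' 0 c (lerN10 R).
  have u1c : {within `[0, c], continuous u1}.
    by move=> u; apply: continuousD; [exact: cst_continuous|exact: yc0].
  have ec : {within `[0, c], continuous e}.
    apply: continuous_subspaceT => u; apply: continuous_comp.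
      exact: scaler_continuous.
    exact: continuous_expR.
  by move=> u; apply: continuousM (ec u); apply: continuousM; exact: u1c.
have [z] := MVT c0 wd wc.
rewrite in_itv/= => /andP[z0 zc].
have wc0 : w c = 0 by rewrite /w /u1 !fctE ycN1 subrr !mul0r.
have w0 : 0 < w 0.
  have u10 : 0 < 1 + y 0 by lra.
  by rewrite /w /u1 /e !fctE /= !mulr_gt0 ?expR_gt0.
have : y (z - 1) <= y m by apply: ym; rewrite in_itv/=; lra.
move=> yz; rewrite wc0 => E.
suff : 0 <= 0 - w 0 by lra.
rewrite E mulr_ge0//; last lra.
rewrite mulr_ge0 ?expR_ge0// mulr_ge0 ?sqr_ge0// mulr_ge0// subr_ge0.
by rewrite ler_pM2l.
Qed.

(** * Limits superior and inferior from eventual bounds *)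

Lemma limf_esup_le (T : choiceType) (X : filteredType T) (R : realType)
    (f : X -> \bar R) (F : set_system X) (a : \bar R) :
  Filter F -> (\forall t \near F, (f t <= a)%E) -> (limf_esup f F <= a)%E.
Proof.
move=> FF fa; rewrite limf_esupE.
apply: (@le_trans _ _ (ereal_sup (f @` [set t | (f t <= a)%E]))).
  by apply: ereal_inf_lbound; exists [set t | (f t <= a)%E].
by apply: ge_ereal_sup => _ [t /= ? <-].
Qed.

Lemma limf_einf_ge (T : choiceType) (X : filteredType T) (R : realType)
    (f : X -> \bar R) (F : set_system X) (a : \bar R) :
  Filter F -> (\forall t \near F, (a <= f t)%E) -> (a <= limf_einf f F)%E.
Proof.
move=> FF fa; rewrite /limf_einf leeNr; apply: limf_esup_le.
by apply: filterS fa => t; rewrite leeN2.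
Qed.

(** Any two sets of a proper filter share a point, whose value separates the infimum over one from
    the supremum over the other. *)
Lemma limf_einf_le_esup (T : choiceType) (X : filteredType T)
    (R : realType) (f : X -> \bar R) (F : set_system X) : ProperFilter F -> (limf_einf f F <= limf_esup f F)%E.
Proof.
move=> FF; rewrite limf_einfE limf_esupE.
apply: ge_ereal_sup => _ [V FV <-]; apply: le_ereal_inf_tmp => _ [W FW <-].
have [t [Vt Wt]] := filter_ex (filterI FV FW).
apply: (@le_trans _ _ (f t)).
  by apply: ereal_inf_lbound; exists t.
by apply: ereal_sup_ubound; exists t.
Qed.

(** * Application to Wright's equation *)

Theorem corollary4 (R : realType) (r : R) (hr : 1 < r) (phi y : R -> R)
    (hy : wright_solution r phi y) (hy0 : -1 < y 0) :
  let F := wrightF r in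
  [/\ (((F \o F) (-1)%R)%:E <= limf_einf (EFin \o y) +oo%R)%E,
      (limf_einf (EFin \o y) +oo%R <= limf_esup (EFin \o y) +oo%R)%E,
      (limf_esup (EFin \o y) +oo%R <= (F (-1)%R)%:E)%E
    & F (-1) = -1 + expR (-1 + r + expR (- r))].
Proof.
move=> F; have r0 : 0 < r by lra.
have ypos (t : R) : 0 <= t -> 0 < 1 + y t.
  by move=> /(wright_gtN1 r0 hy hy0); lra.
have FN1 : F (-1) = -1 + expR (-1 + r + expR (- r)).
  rewrite /F /wrightF oppr_eq0 oner_eq0; congr (-1 + expR _).
  by rewrite mulrN1; field.
set B := F (-1).
have B0 : 0 < B.
  have : 1 + - r < expR (- r) by apply: expR_gt1Dx; lra.
  move=> er; have : expR 0 < expR (-1 + r + expR (- r)) by rewrite ltr_expR; lra.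
  by rewrite /B FN1 expR0; lra.
pose x t := ln (1 + y t).
pose f u := r * (expR u - 1).
pose G u := r * (expR u - u).
have fx t : 0 <= t -> f (x t) = r * y t.
  by move=> t0; rewrite /f /x lnK ?posrE ?ypos// addrAC subrr add0r.
have fmono : {homo f : u v / u < v}.
  by move=> u v uv; rewrite ltr_pM2l// ltrD2r ltr_expR.
have f0 : f 0 = 0 by rewrite /f expR0 subrr mulr0.
have dG (u : R) : is_derive u 1 G (f u).
  exact: (is_deriveZ r (is_deriveB (is_derive_expR u) (is_derive_id u 1))).
(* From t = 1 on, the delayed time is nonnegative, so 1 + y is positive there and [fx] applies. *)
have dx (t : R) : 1 <= t -> is_derive t 1 x (- f (x (t - 1))).
  move=> t1; have t0 : 0 < t by lra.
  rewrite fx; last lra.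
  have [_ _ _ /(_ t t0) yd] := hy.
  have y1d := is_deriveD (is_derive_cst (1 : R) t 1) yd.
  have y1pos := ypos t (ltW t0).
  apply: (is_derive_eq (@is_derive1_comp _ _ (cst 1 + y) _ _ _
    (is_derive1_ln y1pos) y1d)).
  rewrite add0r mulrC.
  by rewrite (mulfK (lt0r_neq0 y1pos)) mulNr.
have [||T1 T1ge xub] := delay_feedback_ub (x := x) (T := 2) r0 fmono f0 dG.
- by move=> t t2; apply: dx; lra.
- move=> t t2; rewrite fx; last lra.
  have := ypos (t - 1); rewrite -(ltr_pM2l r0); lra.
have yub t : T1 <= t -> y t <= B.
  move=> T1t; have /xub := T1t.
  rewrite -ler_expR lnK ?posrE ?ypos//; last lra.
  (* With A = r, the bound (G (- r) - G 0) / r is the exponent in F (-1). *)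
  rewrite (_ : _ / r = -1 + r + expR (- r)); first by rewrite /B FN1; lra.
  by rewrite /G expR0; field; rewrite gt_eqF.
have rB0 : 0 < r * B by rewrite mulr_gt0.
(* The reflection - x solves the same kind of equation with feedback - f (- u), whose primitive is G
   (- u). Starting at [T1 + 1] puts the delayed time past [T1], where y <= B gives A = r B. *)
have [|||||T2 T2ge xlb] := @delay_feedback_ub _ (fun u => - f (- u)) (G \o -%R)
  (- x) (r * B) (T1 + 1) rB0.
- by move=> u v uv; rewrite ltrN2 fmono// ltrN2.
- by rewrite oppr0 f0 oppr0.
- move=> u; apply: (is_derive_eq (is_derive1_comp (dG (- u)) _)).
  by rewrite mulrN1.
- move=> t Tt; rewrite (_ : - f _ = - f (x (t - 1))).
    by apply: is_deriveN; apply: dx; lra.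
  by congr (- f _); exact: opprK.
- move=> t Tt; rewrite !fctE opprK fx; last lra.
  by rewrite lerN2 ler_pM2l// yub; lra.
have ylb t : T2 <= t -> F B <= y t.
  move=> T2t; have : - x t <= _ := xlb t T2t.
  rewrite lerNl -[_ <= x t]ler_expR lnK ?posrE ?ypos//; last lra.
  (* Undoing the reflection turns the bound into the exponent in [F B]; the branch y = 0 of
     [wrightF] is excluded by [B0]. *)
  rewrite (_ : - (_ / _) = (r * B + 1 - expR (r * B)) / B).
    by rewrite /F /wrightF gt_eqF//; lra.
  rewrite /= /G opprK oppr0 expR0.
  by field; rewrite !gt_eqF.
split => //=.
- apply: limf_einf_ge; exists T2; split=> [|t /ltW T2t]; first exact: num_real.
  by rewrite /= lee_fin ylb.
- exact: limf_einf_le_esup.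
- apply: limf_esup_le; exists T1; split=> [|t /ltW T1t]; first exact: num_real.
  by rewrite /= lee_fin yub.
Qed.
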